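(* Let $\gamma>1$, let $\rho_-,\rho_+>0$ and $v_->v_+$ be real constants. For each $\kappa>0$ let $(\rho^\kappa,\rho^\kappa v^\kappa)$ be the Riemann solution of the isentropic Euler equations with pressure $p(\rho)=\kappa\rho^\gamma$ and initial data $(\rho,v)(x,0)=(\rho_\pm,v_\pm)$ for $\pm x>0$. Assume that for some $\kappa_0>0$ the solution $(\rho^{\kappa_0},\rho^{\kappa_0}v^{\kappa_0})$ is composed of a $1$-shock wave and a $2$-rarefaction wave. Then, as $\kappa\to0$, $(\rho^\kappa,\rho^\kappa v^\kappa)$ tends, in the sense of distributions on $\mathbb{R}\times(0,\infty)$, to the $\delta$-shock solution of the pressureless gas system $$\partial_t\rho+\partial_x(\rho v)=0,\qquad \partial_t(\rho v)+\partial_x(\rho v^2)=0$$ with the same Riemann data.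
   Context: The isentropic Euler equations are $\partial_t\rho+\partial_x(\rho v)=0$, $\partial_t(\rho v)+\partial_x(\rho v^2+p)=0$, with $p=\kappa\rho^\gamma$, $\kappa>0$, $\gamma>1$. Put $c=\sqrt{p'(\rho)}=\sqrt{\kappa\gamma}\,\rho^{\frac{\gamma-1}{2}}$, $\lambda_1=v-c$, $\lambda_2=v+c$. Riemann solution. For data with $v_->v_+$, the Riemann solution is the self-similar entropy solution (a function of $\xi=x/t$) consisting of a $1$-wave joining $(\rho_-,v_-)$ on its left to a constant intermediate state $(\rho_*^\kappa,v_*^\kappa)$, $\rho_*^\kappa>0$, followed by a $2$-wave joining $(\rho_*^\kappa,v_*^\kappa)$ to $(\rho_+,v_+)$ on its right. The intermediate state is the unique pair satisfying one of the $1$-wave relations and one of the $2$-wave relations below (a wave is trivial, i.e. absent, when the two states it joins coincide): $1$-rarefaction: $v_*^\kappa=v_-+\frac{2\sqrt{\kappa\gamma}}{\gamma-1}\big(\rho_-^{\frac{\gamma-1}{2}}-(\rho_*^\kappa)^{\frac{\gamma-1}{2}}\big)$, $\rho_*^\kappa<\rho_-$. $1$-shock: $v_*^\kappa=v_--\sqrt{\frac{\kappa((\rho_*^\kappa)^\gamma-\rho_-^\gamma)}{\rho_*^\kappa\rho_-(\rho_*^\kappa-\rho_-)}}\,(\rho_*^\kappa-\rho_-)$, $\rho_*^\kappa>\rho_-$. $2$-rarefaction: $v_*^\kappa=v_+-\frac{2\sqrt{\kappa\gamma}}{\gamma-1}\big(\rho_+^{\frac{\gamma-1}{2}}-(\rho_*^\kappa)^{\frac{\gamma-1}{2}}\big)$,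 $\rho_*^\kappa<\rho_+$. $2$-shock: $v_*^\kappa=v_++\sqrt{\frac{\kappa(\rho_+^\gamma-(\rho_*^\kappa)^\gamma)}{\rho_+\rho_*^\kappa(\rho_+-\rho_*^\kappa)}}\,(\rho_*^\kappa-\rho_+)$, $\rho_*^\kappa>\rho_+$. A shock between two states is a jump travelling at the Rankine–Hugoniot speed $[\rho v]/[\rho]$, where $[\cdot]$ is the jump. A $1$-rarefaction is the continuous fan in which $\lambda_1=\xi$ and $v+\frac{2}{\gamma-1}c$ is constant, for $\xi$ between the values of $\lambda_1$ at its two end states; a $2$-rarefaction is the continuous fan in which $\lambda_2=\xi$ and $v-\frac{2}{\gamma-1}c$ is constant, for $\xi$ between the values of $\lambda_2$ at its two end states. $\delta$-shock solution. For $v_->v_+$, put $$\sigma=\frac{\sqrt{\rho_-}\,v_-+\sqrt{\rho_+}\,v_+}{\sqrt{\rho_-}+\sqrt{\rho_+}},\qquad w(t)=t\sqrt{\rho_-\rho_+}\,(v_--v_+).$$ The $\delta$-shock solution of the pressureless gas system with Riemann data $(\rho_\pm,v_\pm)$ is the pair $(\rho,\rho v)$ where, for each $t>0$, $\rho(\cdot,t)$ is the measure equal to $\rho_-\,dx$ on $x<\sigma t$, $\rho_+\,dx$ on $x>\sigma t$, plus a Dirac mass of weight $w(t)$ at $x=\sigma t$; and $\rho v(\cdot,t)$ is the measure equal to $\rho_-v_-\,dx$ on $x<\sigma t$, $\rho_+v_+\,dx$ on $x>\sigma t$, plus a Dirac mass of weight $\sigma w(t)$ at $x=\sigma t$. 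*)

(* Defs.v *)
From HB Require Import structures.
From mathcomp Require Import all_boot all_order all_algebra.
From mathcomp Require Import all_classical all_reals all_analysis.

Set Implicit Arguments.
Unset Strict Implicit.
Unset Printing Implicit Defensive.

Import Order.TTheory GRing.Theory Num.Theory.
Import numFieldNormedType.Exports.

Local Open Scope classical_set_scope.
Local Open Scope ring_scope.

Record gas_state (R : realType) :=
  GasState { density : R ; velocity : R }.

Definition momentum (R : realType) (u : gas_state R) : R :=
  density u * velocity u.

Variant wave_kind := Trivial | Rarefaction | Shock.

Section IsentropicEuler.
Context {R : realType}.
Variables gamma kappa : R.
Implicit Types (u ul us ur : gas_state R) (U : R -> gas_state R).

(* sqrt (p'(r)) for the pressure law p(r) = kappa * r `^ gamma *)
Definition sound_speed (r : R) : R :=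
  Num.sqrt (kappa * gamma) * r `^ ((gamma - 1) / 2).

Definition lambda1 u : R := velocity u - sound_speed (density u).
Definition lambda2 u : R := velocity u + sound_speed (density u).

Definition riemann_invariant1 u : R :=
  velocity u + 2 / (gamma - 1) * sound_speed (density u).
Definition riemann_invariant2 u : R :=
  velocity u - 2 / (gamma - 1) * sound_speed (density u).

Definition rankine_hugoniot_speed ul ur : R :=
  (momentum ur - momentum ul) / (density ur - density ul).

Definition wave1_relation (k : wave_kind) ul us : Prop :=
  match k with
  | Trivial => us = ul
  | Rarefaction =>
      density us < density ul /\
      velocity us = velocity ul + 2 * Num.sqrt (kappa * gamma) / (gamma - 1) *
        (density ul `^ ((gamma - 1) / 2) - density us `^ ((gamma - 1) / 2))
  | Shock =>
      density us > density ul /\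
      velocity us = velocity ul -
        Num.sqrt (kappa * (density us `^ gamma - density ul `^ gamma) /
                  (density us * density ul * (density us - density ul))) *
        (density us - density ul)
  end.

Definition wave2_relation (k : wave_kind) us ur : Prop :=
  match k with
  | Trivial => us = ur
  | Rarefaction =>
      density us < density ur /\
      velocity us = velocity ur - 2 * Num.sqrt (kappa * gamma) / (gamma - 1) *
        (density ur `^ ((gamma - 1) / 2) - density us `^ ((gamma - 1) / 2))
  | Shock =>
      density us > density ur /\
      velocity us = velocity ur +
        Num.sqrt (kappa * (density ur `^ gamma - density us `^ gamma) /
                  (density ur * density us * (density ur - density us))) *
        (density us - density ur)
  end.

(* A wave with left state [ul] and right state [ur], in the family of
   characteristic speed [lambda], occupies the values of xi = x / t between
   the following two edges; they coincide for a shock and for an absent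
   wave. *)
Definition wave_left_edge (lambda : gas_state R -> R) (k : wave_kind) ul ur : R :=
  if k is Shock then rankine_hugoniot_speed ul ur else lambda ul.
Definition wave_right_edge (lambda : gas_state R -> R) (k : wave_kind) ul ur : R :=
  if k is Shock then rankine_hugoniot_speed ul ur else lambda ur.

(* What a self-similar flow [U] does between these edges. Nothing is
   prescribed on a shock itself. If the wave is absent, both edges are
   [lambda ul], where [U] keeps the constant value [ul]. *)
Definition wave_profile (lambda invariant : gas_state R -> R) (k : wave_kind)
    ul ur U : Prop :=
  match k with
  | Trivial => U (lambda ul) = ul
  | Rarefaction => forall xi, lambda ul <= xi <= lambda ur ->
      [/\ 0 < density (U xi), lambda (U xi) = xi
        & invariant (U xi) = invariant ul]
  | Shock => True
  end.

(* [U], a function of xi = x / t, is the Riemann solution with data [ul], [ur],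
   composed of a 1-wave of kind [k1] and a 2-wave of kind [k2]. *)
Definition riemann_solution_of_kind (k1 k2 : wave_kind) ul ur U : Prop :=
  exists us : gas_state R,
    [/\ 0 < density us, wave1_relation k1 ul us & wave2_relation k2 us ur] /\
    [/\ forall xi, xi < wave_left_edge lambda1 k1 ul us -> U xi = ul,
        wave_profile lambda1 riemann_invariant1 k1 ul us U,
        forall xi, wave_right_edge lambda1 k1 ul us < xi <
                   wave_left_edge lambda2 k2 us ur -> U xi = us,
        wave_profile lambda2 riemann_invariant2 k2 us ur U
      & forall xi, wave_right_edge lambda2 k2 us ur < xi -> U xi = ur].

Definition is_riemann_solution ul ur U : Prop :=
  exists k1 k2, riemann_solution_of_kind k1 k2 ul ur U.

End IsentropicEuler.

Section Distributions.
Context {R : realType}.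

(* Points of the plane are pairs (x, t). *)

Fixpoint continuously_differentiable (n : nat) (phi : R * R -> R) : Prop :=
  continuous phi /\
  if n is m.+1 then
    forall h : R * R, (forall p, derivable phi p h) /\
      continuously_differentiable m (fun p => 'D_h phi p)
  else True.

Definition smooth (phi : R * R -> R) : Prop :=
  forall n, continuously_differentiable n phi.

Definition test_support (phi : R * R -> R) : set (R * R) :=
  closure [set p | phi p != 0].

(* Smooth functions with compact support in R x (0, +oo), extended by zero to
   the whole plane. *)
Definition is_test_function (phi : R * R -> R) : Prop :=
  [/\ smooth phi, compact (test_support phi)
    & test_support phi `<=` [set p | 0 < p.2]].

(* The distribution on R x (0, +oo) given by a locally integrable function *)
Definition function_distribution (f phi : R * R -> R) : R :=
  \int[(@lebesgue_measure R \x @lebesgue_measure R)%E]_(p in [set p | 0 < p.2])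
    (f p * phi p).

(* The distribution on R x (0, +oo) given by a family [m t], t > 0, of signed
   Radon measures on R. The latter may have infinite total variation, hence are
   not library charges; they are represented as functionals on functions of
   compact support. *)
Definition measure_family_distribution (m : R -> (R -> R) -> R)
    (phi : R * R -> R) : R :=
  \int[@lebesgue_measure R]_(t in `]0, +oo[) m t (fun x => phi (x, t)).

Definition cvg_distribution (T : R -> (R * R -> R) -> R) (F : set_system R)
    (T0 : (R * R -> R) -> R) : Prop :=
  forall phi, is_test_function phi -> T kappa phi @[kappa --> F] --> T0 phi.

(* The measure a dx on x < s, b dx on x > s, plus a Dirac mass of weight w
   at x = s *)
Definition jump_dirac_measure (s a b w : R) (psi : R -> R) : R :=
  a * (\int[@lebesgue_measure R]_(x in `]-oo, s[) psi x) +
  b * (\int[@lebesgue_measure R]_(x in `]s, +oo[) psi x) +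
  w * (\int[dirac s]_(x in setT) psi x).

End Distributions.

Section DeltaShock.
Context {R : realType}.
Variables ul ur : gas_state R.

Definition delta_shock_speed : R :=
  (Num.sqrt (density ul) * velocity ul + Num.sqrt (density ur) * velocity ur) /
  (Num.sqrt (density ul) + Num.sqrt (density ur)).

Definition delta_shock_weight (t : R) : R :=
  t * Num.sqrt (density ul * density ur) * (velocity ul - velocity ur).

Definition delta_shock_density (t : R) : (R -> R) -> R :=
  jump_dirac_measure (delta_shock_speed * t) (density ul) (density ur)
    (delta_shock_weight t).

Definition delta_shock_momentum (t : R) : (R -> R) -> R :=
  jump_dirac_measure (delta_shock_speed * t) (momentum ul) (momentum ur)
    (delta_shock_speed * delta_shock_weight t).

End DeltaShock.

(* Main.v *)
Require Import Defs.
From HB Require Import structures.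
From mathcomp Require Import all_boot all_order all_algebra.
From mathcomp Require Import all_classical all_reals all_analysis.
From mathcomp Require Import measurable_realfun ring lra.
Import Order.TTheory GRing.Theory Num.Theory.
Import numFieldNormedType.Exports.
Local Open Scope classical_set_scope.
Local Open Scope ring_scope.

(** As the pressure tends to zero the Riemann solution becomes a pair of shocks
    that enclose a layer of ever larger density and ever smaller width; the
    layer turns into the Dirac mass of the delta-shock.

    Gas dynamics. With an intermediate density of at most [M], the velocity drops
    across either wave by at most a constant times [sqrt (kappa * M `^ gamma)].
    For small [kappa] two such waves cannot make up the fixed drop
    [vm - vp > 0], so the intermediate density exceeds every [M]
    ([intermediate_density_cvgy]). Once it is above [rhom] and [rhop], both waves
    are shocks. The two velocity jumps, each multiplied by the square root of the
    corresponding outer density, are both asymptotic to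
    [sqrt (kappa * r `^ gamma)], [r] being the intermediate density
    ([shock_jumpE]), so the drop [vm - vp] is divided between them in a fixed
    limit proportion, which makes the intermediate velocity tend to the
    delta-shock speed ([intermediate_velocity_cvg]). The Rankine-Hugoniot
    conditions then give the same limit to both shock speeds [s1 < s2], and
    [r * (s2 - s1)] converges to the strength of the delta-shock
    ([layer_mass_cvg]).

    Distributions. For a test function [phi] let [Q s] be its integral over the
    points [(x, t)] with [x > s * t]. Because rays are null sets, a flow with the
    values [a], [b], [c] to the left of, between and to the right of two rays of
    slopes [s1 < s2] acts on [phi] as
    [a * Q(-oo) + (b - a) * Q s1 + (c - b) * Q s2] ([step_distribution]), and the
    jump measure with a Dirac mass of weight [w * t] on the ray of slope [s] acts
    as [a * Q(-oo) + (c - a) * Q s + w * D], where [D] is the integral of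
    [t * phi (s * t, t)] ([jump_dirac_distribution]). Now [- D] is the derivative
    of [Q] at [s], even in the strict sense that
    [Q s1 - Q s2 = (s2 - s1) * (D + o(1))] for both [s1] and [s2] near [s]
    ([right_mass_strict_derivative]). Hence [b * (Q s1 - Q s2)] tends to [w * D]
    as soon as [b * (s2 - s1)] tends to [w], wherever the limit ray lies with
    respect to the layer ([thin_layer_cvg_distribution]). *)

(** * Continuous functions on the plane *)

(** The measurable sets here are those of the product sigma-algebra; an open set
    belongs to it as a countable union of boxes with rational vertices. *)
Lemma open_measurable2 (R : realType) (O : set (R * R)) :
  open O -> measurable O.
Proof.
move=> oO.
pose box (a b c d : rat) : set (R * R) :=
  `](ratr a : R), (ratr b : R)[%classic `*` `](ratr c : R), (ratr d : R)[%classic.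
pose A a b c d := if `[< box a b c d `<=` O >] then box a b c d else set0.
have -> : O = \bigcup_a \bigcup_b \bigcup_c \bigcup_d A a b c d.
  apply/seteqP; split => [[x y] Oxy|p [a _ [b _ [c _ [d _]]]]]; last first.
    by rewrite /A; case: asboolP => // + bp; apply.
  have /nbhs_ballP[e /= e0 eO] : nbhs (x, y) O by exact: open_nbhs_nbhs.
  have ltl (z : R) : z - e < z by rewrite ltrBlDr ltrDl.
  have ltr (z : R) : z < z + e by rewrite ltrDl.
  have [a] := rat_in_itvoo (ltl x); have [b] := rat_in_itvoo (ltr x).
  have [c] := rat_in_itvoo (ltl y); have [d] := rat_in_itvoo (ltr y).
  rewrite !in_itv/= => /andP[yd dy] /andP[yc cy] /andP[xb bx] /andP[xa ax].
  exists a => //; exists b => //; exists c => //; exists d => //.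
  rewrite /A; case: asboolP => [_|]; first by split; rewrite /= in_itv/= ?ax ?cy.
  case=> -[x' y'] [/=]; rewrite !in_itv/= => /andP[ax' x'b] /andP[cy' y'd].
  apply: eO; split; rewrite /ball/= ltr_norml ltrBlDr ltrBrDr; apply/andP; split; lra.
do 4 (apply: bigcupT_measurable_rat => ?); rewrite /A; case: ifP => // _.
exact: measurableX.
Qed.

Lemma continuous_measurable_fun2 (R : realType) (f : R * R -> R) :
  continuous f -> measurable_fun setT f.
Proof.
move=> /continuousP cf; apply: (measurability _ (RGenOpens.measurableE R)).
move=> _ [_ [a [b ->] <-]]; rewrite setTI; apply: open_measurable2.
exact/cf/interval_open.
Qed.

Lemma continuous_supported_integrable {R : realType} (f : R -> R) (L : R) :
  continuous f -> (forall x, L < `|x| -> f x = 0) ->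
  (@lebesgue_measure R).-integrable setT (EFin \o f).
Proof.
move=> cf f0; have -> : EFin \o f = (EFin \o f) \_ `[- L, L].
  apply/funext => x; rewrite patchE; case: ifPn => // /negP xL /=.
  rewrite f0// ltNge ler_norml; apply/negP => h; apply: xL.
  by rewrite inE/= in_itv.
apply/integrable_restrict => //=; rewrite setTI.
apply: continuous_compact_integrable; first exact: segment_compact.
exact: continuous_subspaceT.
Qed.

(** * Test functions and their sections *)

Section TestFunctions.
Context {R : realType}.
Notation mu := (@lebesgue_measure R).
Notation mu2 := (@lebesgue_measure R \x @lebesgue_measure R)%E.

(** All that the estimates use of a test function besides its continuity; one
    constant serves for the height of the graph and for both sides of the box. *)
Definition bounded_by_box (phi : R * R -> R) (L : R) : Prop :=
  (forall p, phi p != 0 -> `|p.1| <= L /\ 0 < p.2 <= L) /\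
  (forall p, `|phi p| <= L).

Lemma test_function_bounded {phi : R * R -> R} : is_test_function phi ->
  continuous phi /\ exists2 L, 0 < L & bounded_by_box phi L.
Proof.
move=> [sphi cK K0]; have [cphi _] := sphi 0%N; split=> //.
have sub p : phi p != 0 -> test_support phi p by move=> ?; apply: subset_closure.
have [M [_ bM]] := compact_bounded cK.
have [N [_ bN]] : bounded_set (phi @` test_support phi).
  by apply/compact_bounded/continuous_compact => //; exact: continuous_subspaceT.
pose L := `|M| + `|N| + 1; have L0 : 0 < L by rewrite ltr_wpDl.
have ML : M < L by rewrite /L (le_lt_trans (ler_norm M))// -addrA ltrDl ltr_wpDl.
have NL : N < L by rewrite /L (le_lt_trans (ler_norm N))// addrAC ltrDr ltr_wpDl.
exists L => //; split => p.
  move=> /sub Kp; have := bM _ ML _ Kp; rewrite /= prod_normE ge_max => /andP[p1 p2].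
  by split=> //; rewrite (K0 _ Kp)//= (le_trans (ler_norm _)).
have [->|/sub Kp] := eqVneq (phi p) 0; first by rewrite normr0 ltW.
by apply: (bN _ NL); exists p.
Qed.

Lemma integrable_bounded_by_box {phi : R * R -> R} {L : R} :
  continuous phi -> bounded_by_box phi L -> mu2.-integrable setT (EFin \o phi).
Proof.
move=> cphi [boxphi bphi].
pose B : set (R * R) := `[- L, L]%classic `*` `[0, L]%classic.
have -> : EFin \o phi = (EFin \o phi) \_ B.
  apply/funext => p; rewrite patchE; case: ifPn => // /negP Bp /=.
  have [->//|/boxphi[p1 /andP[p2 p3]]] := eqVneq (phi p) 0.
  by exfalso; apply: Bp; rewrite inE; split; rewrite /= in_itv/= -?ler_norml// (ltW p2).
have mB : measurable B by exact: measurableX.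
apply/integrable_restrict => //=; rewrite setTI.
apply: measurable_bounded_integrable => //.
- rewrite [ltLHS](_ : _ = (mu `[(- L)%R, L]%classic * mu `[0%R, L]%classic)%E); last first.
    exact: product_measure1E.
  rewrite !lebesgue_measure_itv/=.
  by do 2 case: ifP => _; rewrite ?mul0e ?mule0 -?EFinB -?EFinM ltry.
- by apply: measurable_funTS; exact: continuous_measurable_fun2.
- exists L; split; first by rewrite num_real.
  by move=> M LM p _; apply: (le_trans (bphi p)); exact: ltW.
Qed.

Lemma slice_integrable {phi : R * R -> R} {L : R} (t : R) :
  continuous phi -> bounded_by_box phi L ->
  mu.-integrable setT (EFin \o (fun x => phi (x, t))).
Proof.
move=> cphi [boxphi _]; apply: (@continuous_supported_integrable _ _ L).
  move=> x; apply: (@cvg_comp _ _ _ (fun x => (x, t)) phi _ (nbhs (x, t)));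
    last exact: cphi.
  by apply: (@cvg_pair _ _ _ _ (nbhs x) (nbhs t)); [exact: cvg_id|exact: cvg_cst].
move=> x Lx; apply/eqP/negP => /negP/boxphi[/=].
by rewrite leNgt Lx.
Qed.

End TestFunctions.

Lemma integrable_fubini_G {d1 d2} {T1 : measurableType d1}
    {T2 : measurableType d2} {R : realType}
    {m1 : {sigma_finite_measure set T1 -> \bar R}}
    {m2 : {sigma_finite_measure set T2 -> \bar R}} {f : T1 * T2 -> \bar R} :
  (m1 \x m2)%E.-integrable setT f -> m2.-integrable setT (fubini_G m1 f).
Proof.
move=> fi; have mf := measurable_int _ fi.
have mabs : measurable_fun setT (fun p => `|f p|)%E.
  by apply: measurableT_comp; [|exact: mf].
apply/integrableP; split; first exact: measurable_fubini_G fi.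
apply: le_lt_trans ((integrable21ltyP m1 m2 mf).1 fi).
apply: ge0_le_integral => //.
- by apply: measurableT_comp => //; exact: measurable_fubini_G fi.
- by apply: (@measurable_fun_fubini_tonelli_G _ _ _ _ _ m1 (fun p => `|f p|)%E mabs) => p.
- move=> t _; apply: le_abse_integral => //.
  exact: measurable_fun_pair1.
Qed.

Section SectionIntegrals.
Context {R : realType}.
Notation mu := (@lebesgue_measure R).
Notation mu2 := (@lebesgue_measure R \x @lebesgue_measure R)%E.
Variables (phi : R * R -> R) (L : R).
Hypotheses (cphi : continuous phi) (boxphi : bounded_by_box phi L).

(** Integrating first in [x] makes rays null sets ([ray_integral0]) and allows a
    comparison with the measures on the lines of constant [t]. *)
Lemma section_integral (A : set (R * R)) : measurable A ->
  mu.-integrable setT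
    (EFin \o (fun t => \int[mu]_(x in [set x | A (x, t)]) phi (x, t))) /\
  \int[mu2]_(p in A) phi p =
  \int[mu]_t \int[mu]_(x in [set x | A (x, t)]) phi (x, t).
Proof.
move=> mA; pose g := phi \_ A.
have ig : mu2.-integrable setT (EFin \o g).
  rewrite -restrict_EFin; apply/integrable_restrict => //=; rewrite setTI.
  exact: integrableS (integrable_bounded_by_box cphi boxphi).
have mAt t : measurable [set x | A (x, t)].
  by have := measurable_ysection t mA; rewrite /ysection; under eq_set do rewrite inE.
have gE t : (fun x => g (x, t)) = (fun x => phi (x, t)) \_ [set x | A (x, t)].
  by apply/funext => x; rewrite /g !patchE; congr (if _ then _ else _); rewrite !inE.
have it t : mu.-integrable setT (EFin \o (fun x => g (x, t))).
  rewrite gE -restrict_EFin; apply/integrable_restrict => //=; first exact: mAt.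
  rewrite setTI; have := slice_integrable t cphi boxphi.
  by apply: integrableS => //; exact: mAt.
have FE : (EFin \o (fun t => \int[mu]_(x in [set x | A (x, t)]) phi (x, t))) =
    fubini_G mu (EFin \o g).
  apply/funext => t; rewrite /= Rintegral_mkcond -gE /Rintegral fineK//.
  by apply: integrable_fin_num => //; exact: (it t).
split; first by rewrite FE; exact: integrable_fubini_G.
rewrite Rintegral_mkcond -/g; congr fine.
transitivity (\int[mu]_t fubini_G mu (EFin \o g) t)%E; last by rewrite -FE.
exact/esym/(integral21_prod_meas1 ig).
Qed.

End SectionIntegrals.

(** * The mass to the right of a ray *)

Section NearConstant.
Context {R : realType}.
Notation mu := (@lebesgue_measure R).

Lemma Rintegral_near_cst {f : R -> R} {a b c e : R} : a <= b ->
  mu.-integrable `]a, b] (EFin \o f) ->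
  (forall x, a < x <= b -> `|f x - c| <= e) ->
  `|\int[mu]_(x in `]a, b]) f x - c * (b - a)| <= e * (b - a).
Proof.
move=> ab fi fe.
have mab : mu `]a, b]%classic = (b - a)%:E.
  by rewrite lebesgue_measure_itv/= lte_fin; case: ltgtP ab => // ->; rewrite subrr.
have ci k : mu.-integrable `]a, b]%classic (EFin \o cst k).
  apply: measurable_bounded_integrable => //; first by rewrite [ltLHS]mab ltry.
  exact: bounded_cst.
have cE k : \int[mu]_(x in `]a, b]) cst k x = k * (b - a).
  by rewrite Rintegral_cst// [X in fine X]mab.
have di : mu.-integrable `]a, b]%classic (EFin \o (fun x => f x - c)).
  by rewrite (_ : _ \o _ = (EFin \o f) \- (EFin \o cst c))%E//; exact: integrableB.
rewrite -cE -RintegralB//.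
apply: (le_trans (le_normr_Rintegral _ di)) => //; rewrite -cE.
apply: le_Rintegral => //.
exact: (integrable_abse di).
Qed.

End NearConstant.

Lemma Rintegral_addZ {d} {T : measurableType d} {R : realType}
    {nu : {measure set T -> \bar R}} {u v : T -> R} (k : R) :
  nu.-integrable setT (EFin \o u) -> nu.-integrable setT (EFin \o v) ->
  nu.-integrable setT (EFin \o (fun x => u x + k * v x)) /\
  \int[nu]_x (u x + k * v x) = \int[nu]_x u x + k * \int[nu]_x v x.
Proof.
move=> iu iv.
have ikv : nu.-integrable setT (EFin \o (fun x => k * v x)).
  exact: (integrableZl measurableT k iv).
split; last by rewrite RintegralD// RintegralZl.
rewrite (_ : _ \o _ = (EFin \o u) \+ (EFin \o (fun x => k * v x)%R))%E//.
exact: integrableD.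
Qed.

Section HalfPlanes.
Context {R : realType}.
Notation mu := (@lebesgue_measure R).
Notation mu2 := (@lebesgue_measure R \x @lebesgue_measure R)%E.
Implicit Types (phi : R * R -> R) (s t : R).

(** The points [(x, t)], [t > 0], at which the self-similar variable [x / t] is
    respectively below, equal to and above [s]. *)
Definition left_half s : set (R * R) := [set p | p.1 < s * p.2].
Definition ray s : set (R * R) := [set p | p.1 = s * p.2].
Definition right_half s : set (R * R) := [set p | s * p.2 < p.1].

Definition right_mass phi s := \int[mu2]_(p in right_half s) phi p.
(** Minus the derivative of [right_mass phi], and the action on [phi] of a Dirac
    mass of weight [t] on the ray of slope [s]. *)
Definition ray_moment phi s := \int[mu]_t (t * phi (s * t, t)).

Let measurable_offset s : measurable_fun setT (fun p : R * R => p.1 - s * p.2).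
Proof.
apply: continuous_measurable_fun2 => p; apply: cvgB; first exact: cvg_fst.
by apply: cvgM; [exact: cvg_cst|exact: cvg_snd].
Qed.

Lemma measurable_left_half s : measurable (left_half s).
Proof.
rewrite (_ : left_half s = setT `&` (fun p => p.1 - s * p.2) @^-1` `]-oo, 0[).
  exact: measurable_offset.
by apply/seteqP; split => p /=; rewrite in_itv/= subr_lt0// => -[].
Qed.

Lemma measurable_right_half s : measurable (right_half s).
Proof.
rewrite (_ : right_half s = setT `&` (fun p => p.1 - s * p.2) @^-1` `]0, +oo[).
  exact: measurable_offset.
by apply/seteqP; split => p /=; rewrite in_itv/= andbT subr_gt0// => -[].
Qed.

Lemma measurable_ray s : measurable (ray s).
Proof.
rewrite (_ : ray s = setT `&` (fun p => p.1 - s * p.2) @^-1` [set 0]).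
  exact: measurable_offset.
by apply/seteqP; split => p /= => [->|[_ /subr0_eq]//]; rewrite subrr.
Qed.

Variables (phi : R * R -> R) (L : R).
Hypotheses (L0 : 0 < L) (cphi : continuous phi) (boxphi : bounded_by_box phi L).

Let out_t t : t <= 0 \/ L < t -> forall x, phi (x, t) = 0.
Proof.
move=> tL x; apply/eqP/negP => /negP/(boxphi.1)[_ /= /andP[t0 t1]].
by case: tL => ?; lra.
Qed.

Lemma right_mass_sections s :
  mu.-integrable setT
    (EFin \o (fun t => \int[mu]_(x in `]s * t, +oo[) phi (x, t))) /\
  right_mass phi s = \int[mu]_t \int[mu]_(x in `]s * t, +oo[) phi (x, t).
Proof.
have := section_integral _ _ cphi boxphi _ (measurable_right_half s).
suff -> : (fun t => \int[mu]_(x in [set x | right_half s (x, t)]) phi (x, t)) =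
  (fun t => \int[mu]_(x in `]s * t, +oo[) phi (x, t)) by [].
apply/funext => t; congr Rintegral; apply/seteqP.
by split => x /=; rewrite in_itv/= andbT.
Qed.

Lemma ray_integral0 s : \int[mu2]_(p in ray s) phi p = 0.
Proof.
have [_ ->] := section_integral _ _ cphi boxphi _ (measurable_ray s).
rewrite (_ : (fun t => _) = cst 0); last first.
  apply/funext => t; rewrite -[RHS](Rintegral_set1 (fun x => phi (x, t)) (s * t)).
  by congr Rintegral.
by rewrite Rintegral_cst// mul0r.
Qed.

Lemma ray_moment_integrable s :
  mu.-integrable setT (EFin \o (fun t => t * phi (s * t, t))).
Proof.
apply: (@continuous_supported_integrable _ _ L) => [t|t Lt]; last first.
  rewrite out_t ?mulr0//; have [t0|t0] := ltP t 0; first by left; exact: ltW.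
  by right; rewrite -[t]ger0_norm.
apply: cvgM; first exact: cvg_id.
apply: (@cvg_comp _ _ _ (fun t => (s * t, t)) phi _ (nbhs (s * t, t)));
  last exact: cphi.
apply: (@cvg_pair _ _ _ _ (nbhs (s * t)) (nbhs t)); last exact: cvg_id.
by apply: cvgM; [exact: cvg_cst|exact: cvg_id].
Qed.

(** Uniformity in [t] comes from the compactness of [[0, L]]. *)
Lemma equicontinuous_at_ray s e : 0 < e ->
  \forall s' \near s, forall t, 0 <= t <= L ->
    `|phi (s' * t, t) - phi (s * t, t)| <= e.
Proof.
move=> e0.
pose P s' t : Prop := `|phi (s' * t, t) - phi (s * t, t)| <= e.
have /compact_near_coveringP cov := @segment_compact R 0 L.
suff : \near s, `[0, L]%classic `<=` P s.
  by apply: filterS => s' h t tL; apply: h; rewrite /= in_itv.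
apply: (cov _ (nbhs s) P) => t _.
have cs : phi (q.2 * q.1, q.1) - phi (s * q.1, q.1) @[q --> (t, s)] -->
          phi (s * t, t) - phi (s * t, t).
  apply: cvgB.
  - apply: (@cvg_comp _ _ _ (fun q => (q.2 * q.1, q.1)) phi _ (nbhs (s * t, t)));
    last exact: cphi.
    apply: (@cvg_pair _ _ _ _ (nbhs (s * t)) (nbhs t)); last exact: cvg_fst.
    by apply: cvgM; [exact: cvg_snd|exact: cvg_fst].
  - apply: (@cvg_comp _ _ _ (fun q => (s * q.1, q.1)) phi _ (nbhs (s * t, t)));
    last exact: cphi.
    apply: (@cvg_pair _ _ _ _ (nbhs (s * t)) (nbhs t)); last exact: cvg_fst.
    by apply: cvgM; [exact: cvg_cst|exact: cvg_fst].
rewrite subrr in cs; move/cvgr0_norm_le : cs => /(_ _ e0).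
by [].
Qed.

(** On each line of constant [t] the two masses differ by the integral of [phi]
    over an interval of length [(s2 - s1) * t], on which [phi] is almost equal to
    its value at [s * t]. Both slopes are allowed to vary, and the error is
    relative to their distance: in the application this distance is multiplied
    by a factor that goes to infinity, while nothing is known about how fast
    each slope separately approaches [s]. *)
Lemma right_mass_strict_derivative s e : 0 < e ->
  exists2 d, 0 < d &
  forall s1 s2, s1 <= s2 -> `|s1 - s| < d -> `|s2 - s| < d ->
  `|right_mass phi s1 - right_mass phi s2 - ray_moment phi s * (s2 - s1)| <=
  e * (s2 - s1).
Proof.
move=> e0; have e'0 : 0 < e / L / L by rewrite !divr_gt0.
have /nbhs_ballP[d /= d0 near_s] := equicontinuous_at_ray s _ e'0.
exists d => // s1 s2 s12 s1d s2d.
pose tail s' t := \int[mu]_(x in `]s' * t, +oo[) phi (x, t).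
pose G t := tail s1 t - tail s2 t - (s2 - s1) * (t * phi (s * t, t)).
have [i1 Q1] := right_mass_sections s1; have [i2 Q2] := right_mass_sections s2.
have i12 : mu.-integrable setT (EFin \o (fun t => tail s1 t - tail s2 t)).
  rewrite (_ : _ \o _ = (EFin \o tail s1) \- (EFin \o tail s2))%E//.
  exact: integrableB.
have isv : mu.-integrable setT
    (EFin \o (fun t => (s2 - s1) * (t * phi (s * t, t)))).
  exact: (integrableZl measurableT (s2 - s1) (ray_moment_integrable s)).
have iG : mu.-integrable setT (EFin \o G).
  rewrite (_ : _ \o _ = (EFin \o (fun t => tail s1 t - tail s2 t)%R) \-
    (EFin \o (fun t => (s2 - s1) * (t * phi (s * t, t)))%R))%E//.
  exact: integrableB.
have -> : right_mass phi s1 - right_mass phi s2 - ray_moment phi s * (s2 - s1) =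
    \int[mu]_t G t.
  rewrite Q1 Q2 RintegralB// RintegralB// RintegralZl//; first by rewrite mulrC.
  exact: ray_moment_integrable.
(* One factor [L] of the error is the length of this interval, the other one
   bounds the length [(s2 - s1) * t] of the sections. *)
have -> : \int[mu]_t G t = \int[mu]_(t in `]0, L]) G t.
  rewrite [RHS]Rintegral_mkcond; congr Rintegral; apply/funext => t.
  rewrite patchE; case: ifPn => // /negP tL.
  have out x : phi (x, t) = 0.
    apply: out_t; have [t0|t0] := leP t 0; [by left|right].
    by rewrite ltNge; apply/negP => tL'; apply: tL; rewrite inE/= in_itv/= t0.
  rewrite /G /tail out !mulr0 subr0.
  by under eq_Rintegral do rewrite out; under [X in _ - X]eq_Rintegral do rewrite out;
     rewrite !Rintegral_cst// !mul0r subrr.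
suff bG t : 0 < t <= L -> `|G t - 0| <= e / L / L * (s2 - s1) * L.
  have := Rintegral_near_cst (ltW L0) (integrableS measurableT _ _ iG) bG.
  rewrite mul0r !subr0 => /(_ _ _)/le_trans; apply => //.
  by rewrite le_eqVlt; apply/orP; left; apply/eqP; field; rewrite gt_eqF.
move=> /andP[t0 tL]; rewrite subr0.
have le12 : s1 * t <= s2 * t by rewrite ler_wpM2r// ltW.
have islice := slice_integrable t cphi boxphi.
have -> : G t = \int[mu]_(x in `]s1 * t, s2 * t]) phi (x, t) -
    phi (s * t, t) * (s2 * t - s1 * t).
  have tailB : tail s1 t - \int[mu]_(x in `]s1 * t, s2 * t]) phi (x, t) = tail s2 t.
    by apply: Rintegral_itvB => //; exact: integrableS islice.
  by rewrite /G -tailB; ring.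
have near_ray x : s1 * t < x <= s2 * t ->
    `|phi (x, t) - phi (s * t, t)| <= e / L / L.
  move=> /andP[x1 x2]; rewrite -[x](@divfK _ t) ?gt_eqF//.
  apply: near_s; last by rewrite ltW.
  rewrite /ball/= distrC.
  have : s1 < x / t <= s2 by rewrite ltr_pdivlMr// ler_pdivrMr// x1.
  move=> /andP[y1 y2]; move: s1d s2d; rewrite !ltr_norml => /andP[d1 _] /andP[_ d2].
  apply/andP; split; first by apply: lt_trans d1 _; rewrite ltrD2r.
  by apply: le_lt_trans d2; rewrite lerD2r.
apply: (le_trans (Rintegral_near_cst le12 _ near_ray)).
  exact: integrableS islice.
rewrite -mulrBl mulrA ler_wpM2l// mulr_ge0//; last by rewrite subr_ge0.
exact: ltW.
Qed.

(** * Step functions and jump measures as distributions *)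

Let restrict_integrable (A : set (R * R)) : measurable A ->
  mu2.-integrable setT (EFin \o (phi \_ A)).
Proof.
move=> mA; rewrite -restrict_EFin; apply/integrable_restrict => //=; rewrite setTI.
exact: integrableS (integrable_bounded_by_box cphi boxphi).
Qed.

(** The last two terms of the decomposition in the proof account for the values
    of [m] at [s1] and [s2]; they vanish on integration, rays being null sets. *)
Lemma step_distribution (m : R -> R) s1 s2 a b c : s1 < s2 ->
  (forall xi, xi < s1 -> m xi = a) ->
  (forall xi, s1 < xi < s2 -> m xi = b) ->
  (forall xi, s2 < xi -> m xi = c) ->
  function_distribution (fun p => m (p.1 / p.2)) phi =
  a * \int[mu2]_p phi p + (b - a) * right_mass phi s1 +
  (c - b) * right_mass phi s2.
Proof.
move=> s12 ma mb mc; rewrite /function_distribution Rintegral_mkcond.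
rewrite (_ : _ \_ _ = fun p => 0 + a * phi p + (b - a) * (phi \_ (right_half s1)) p +
    (c - b) * (phi \_ (right_half s2)) p + (m s1 - a) * (phi \_ (ray s1)) p +
    (m s2 - b) * (phi \_ (ray s2)) p).
  have i0 : mu2.-integrable setT (EFin \o (fun=> 0 : R)) by exact: integrable0.
  have iphi := integrable_bounded_by_box cphi boxphi.
  have [i1 e1] := Rintegral_addZ a i0 iphi.
  have [i2 e2] := Rintegral_addZ (b - a) i1 (restrict_integrable _ (measurable_right_half s1)).
  have [i3 e3] := Rintegral_addZ (c - b) i2 (restrict_integrable _ (measurable_right_half s2)).
  have [i4 e4] := Rintegral_addZ (m s1 - a) i3 (restrict_integrable _ (measurable_ray s1)).
  have [_ e5] := Rintegral_addZ (m s2 - b) i4 (restrict_integrable _ (measurable_ray s2)).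
  rewrite e5 e4 e3 e2 e1 Rintegral_cst// mul0r add0r.
  by rewrite -!(Rintegral_mkcond mu2) !ray_integral0 !mulr0 !addr0.
apply/funext => -[x t]; rewrite patchE; case: ifPn => /= [|/negP t0]; last first.
  have out : phi (x, t) = 0.
    by apply: out_t; left; rewrite leNgt; apply/negP => h; apply: t0; rewrite inE.
  by rewrite !patchE out !if_same !mulr0 !addr0.
have chiE A p : (phi \_ A) p = if p \in A then phi p else 0 by [].
rewrite inE /= => t0; rewrite !chiE.
have right_halfE s : ((x, t) \in right_half s) = (s < x / t).
  by rewrite ltr_pdivlMr//; apply/idP/idP; rewrite inE.
have rayE s : ((x, t) \in ray s) = (x / t == s).
  have t_neq0 := lt0r_neq0 t0.
  apply/idP/eqP; rewrite inE /ray/=; first by move=> ->; rewrite mulfK.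
  by move=> <-; rewrite divfK.
rewrite !right_halfE !rayE.
have [xi1|xi1|->] := ltgtP (x / t) s1.
- by rewrite ma// (lt_gtF (lt_trans xi1 s12)) (lt_eqF (lt_trans xi1 s12)) !mulr0; ring.
- have [xi2|xi2|->] := ltgtP (x / t) s2.
  + by rewrite mb ?xi1//; ring.
  + by rewrite mc//; ring.
  + by ring.
- by rewrite lt_gtF// lt_eqF//; ring.
Qed.

(** Having the left mass as a total minus a right mass lets every distribution
    in play be expressed by the single function [right_mass phi]. *)
Lemma left_mass_sections s :
  mu.-integrable setT
    (EFin \o (fun t => \int[mu]_(x in `]-oo, s * t[) phi (x, t))) /\
  \int[mu2]_p phi p - right_mass phi s =
  \int[mu]_t \int[mu]_(x in `]-oo, s * t[) phi (x, t).
Proof.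
have := section_integral _ _ cphi boxphi _ (measurable_left_half s).
have -> : (fun t => \int[mu]_(x in [set x | left_half s (x, t)]) phi (x, t)) =
    (fun t => \int[mu]_(x in `]-oo, s * t[) phi (x, t)).
  by apply/funext => t; congr Rintegral; apply/seteqP; split => x /=; rewrite in_itv.
move=> [il <-]; split=> //.
have [i1 e1] := Rintegral_addZ 1 (restrict_integrable _ (measurable_left_half s))
  (restrict_integrable _ (measurable_right_half s)).
have [_ e2] := Rintegral_addZ 1 i1 (restrict_integrable _ (measurable_ray s)).
rewrite e1 !mul1r -!(Rintegral_mkcond mu2) ray_integral0 addr0 in e2.
apply/eqP; rewrite subr_eq -e2; apply/eqP/eq_Rintegral => -[x t] _.
have chiE A p : (phi \_ A) p = if p \in A then phi p else 0 by [].
have memE (A : set (R * R)) (b : bool) : (A (x, t) <-> b) -> ((x, t) \in A) = b.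
  by move=> Ab; apply/idP/idP; rewrite inE => /Ab.
rewrite !chiE (memE (left_half s) (x < s * t)) // (memE (right_half s) (s * t < x)) //.
rewrite (memE (ray s) (x == s * t)); last by split => /eqP.
by case: ltgtP => _; ring.
Qed.

Lemma jump_dirac_distribution s a c w :
  measure_family_distribution
    (fun t => jump_dirac_measure (s * t) a c (w * t)) phi =
  a * \int[mu2]_p phi p + (c - a) * right_mass phi s + w * ray_moment phi s.
Proof.
have [il el] := left_mass_sections s; have [ir er] := right_mass_sections s.
have i0 : mu.-integrable setT (EFin \o (fun=> 0 : R)) by exact: integrable0.
have [i1 e1] := Rintegral_addZ a i0 il.
have [i2 e2] := Rintegral_addZ c i1 ir.
have [_ e3] := Rintegral_addZ w i2 (ray_moment_integrable s).
rewrite /measure_family_distribution Rintegral_mkcond.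
rewrite (_ : _ \_ _ = fun t => 0 + a * (\int[mu]_(x in `]-oo, s * t[) phi (x, t)) +
    c * (\int[mu]_(x in `]s * t, +oo[) phi (x, t)) + w * (t * phi (s * t, t))).
  by rewrite e3 e2 e1 -el -er Rintegral_cst// /ray_moment; ring.
apply/funext => t; rewrite patchE; case: ifPn => [_|/negP t0].
  rewrite /jump_dirac_measure add0r; congr (_ + _).
  rewrite -mulrA; congr (_ * (_ * _)).
  rewrite /Rintegral integral_dirac//=; first by rewrite indicE mem_setT mul1r.
  apply/measurable_EFinP/measurable_fun_pair1; exact: continuous_measurable_fun2.
have out x : phi (x, t) = 0.
  by apply: out_t; left; rewrite leNgt; apply/negP => h; apply: t0; rewrite inE/= in_itv/= h.
rewrite out !mulr0 addr0.
under eq_Rintegral do rewrite out; under [X in _ + c * X]eq_Rintegral do rewrite out.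
by rewrite !Rintegral_cst// !mul0r !mulr0 !addr0.
Qed.

End HalfPlanes.

(** * Thin layers *)

Section ThinLayers.
Context {R : realType}.

Lemma right_mass_continuous (phi : R * R -> R) (L : R) : 0 < L ->
  continuous phi -> bounded_by_box phi L -> continuous (right_mass phi).
Proof.
move=> L0 cphi boxphi s; set D := ray_moment phi s.
apply/cvgrPdist_lt => e e0.
have [d d0 strict] := right_mass_strict_derivative _ _ L0 cphi boxphi s 1 ltr01.
rewrite -/D in strict.
have lip s1 s2 : s1 <= s2 -> `|s1 - s| < d -> `|s2 - s| < d ->
    `|right_mass phi s1 - right_mass phi s2| <= (`|D| + 1) * (s2 - s1).
  move=> s12 s1d s2d.
  rewrite -(subrK (D * (s2 - s1)) (right_mass phi s1 - right_mass phi s2)).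
  rewrite (le_trans (ler_normD _ _))// normrM [`|s2 - s1|]ger0_norm ?subr_ge0//.
  by rewrite mulrDl addrC lerD2l strict.
have D1 : 0 < `|D| + 1 by rewrite ltr_wpDl.
near=> s'.
have s'd : `|s' - s| < d by rewrite distrC; near: s'; exact: cvgr_dist_lt.
have s'e : `|s' - s| < e / (`|D| + 1).
  by rewrite distrC; near: s'; apply: cvgr_dist_lt => //; exact: divr_gt0.
have sd : `|s - s| < d by rewrite subrr normr0.
apply: (@le_lt_trans _ _ ((`|D| + 1) * `|s' - s|)); last first.
  by rewrite mulrC -ltr_pdivlMr.
have [ss'|/ltW s's] := leP s s'.
  by rewrite [`|s' - s|]ger0_norm ?subr_ge0// lip.
by rewrite distrC [`|s' - s|]distrC [`|s - s'|]ger0_norm ?subr_ge0// lip.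
Unshelve. all: by end_near. Qed.

(** After regrouping, [a * Q(-oo) + (c * Q s2 - a * Q s1) + b * (Q s1 - Q s2)] is
    the action of the flow. The first two terms converge by continuity of [Q];
    the last one is [b * (s2 - s1) * D] up to an error that is small relative to
    the bounded quantity [b * (s2 - s1)]. *)
Lemma thin_layer_cvg_distribution (F : set_system R) {FF : ProperFilter F}
    (m : R -> R -> R) (s1 s2 b : R -> R) (sigma a c w : R) :
  s1 k @[k --> F] --> sigma -> s2 k @[k --> F] --> sigma ->
  b k * (s2 k - s1 k) @[k --> F] --> w ->
  (\forall k \near F, [/\ s1 k < s2 k,
    forall xi, xi < s1 k -> m k xi = a,
    forall xi, s1 k < xi < s2 k -> m k xi = b k
    & forall xi, s2 k < xi -> m k xi = c]) ->
  cvg_distribution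
    (fun k => function_distribution (fun p : R * R => m k (p.1 / p.2))) F
    (measure_family_distribution
      (fun t => jump_dirac_measure (sigma * t) a c (w * t))).
Proof.
move=> s1s s2s bs step phi /test_function_bounded[cphi [L L0 boxphi]].
rewrite (jump_dirac_distribution _ _ cphi boxphi).
set J := Rintegral _ _ _; set D := ray_moment phi sigma; pose Q := right_mass phi.
have cQ : continuous Q := right_mass_continuous _ _ L0 cphi boxphi.
have Q1 : Q (s1 k) @[k --> F] --> Q sigma by exact: cvg_comp _ _ s1s (cQ sigma).
have Q2 : Q (s2 k) @[k --> F] --> Q sigma by exact: cvg_comp _ _ s2s (cQ sigma).
have layer : b k * (Q (s1 k) - Q (s2 k)) @[k --> F] --> w * D.
  have split_layer k : b k * (Q (s1 k) - Q (s2 k)) = b k * (s2 k - s1 k) * D +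
      b k * (Q (s1 k) - Q (s2 k) - D * (s2 k - s1 k)) by ring.
  under eq_fun do rewrite split_layer.
  rewrite -[w * D]addr0; apply: cvgD; first by apply: cvgM => //; exact: cvg_cst.
  apply/cvgr0Pnorm_le => e e0.
  have w1 : 0 < `|w| + 1 by rewrite ltr_wpDl.
  have e'0 : 0 < e / (`|w| + 1) by rewrite divr_gt0.
  have [d d0 strict] := right_mass_strict_derivative _ _ L0 cphi boxphi sigma _ e'0.
  near=> k.
  have s12 : s1 k < s2 k by near: k; apply: filterS step => k [].
  have s1d : `|s1 k - sigma| < d by rewrite distrC; near: k; exact: cvgr_dist_lt.
  have s2d : `|s2 k - sigma| < d by rewrite distrC; near: k; exact: cvgr_dist_lt.
  have bw : `|b k * (s2 k - s1 k)| < `|w| + 1.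
    by near: k; apply: cvgr_norm_lt bs _ _; rewrite ltrDl.
  rewrite normrM; apply: le_trans (ler_wpM2l (normr_ge0 _) (strict _ _ (ltW s12) s1d s2d)) _.
  rewrite mulrCA -[s2 k - s1 k]ger0_norm ?subr_ge0 1?ltW// -normrM.
  by rewrite mulrAC ltr_pdivrMr// ltr_pM2l.
have -> : a * J + (c - a) * right_mass phi sigma + w * D =
  a * J + (c * Q sigma - a * Q sigma) + w * D by rewrite /Q; ring.
have fdE : \forall k \near F, a * J + (c * Q (s2 k) - a * Q (s1 k)) +
    b k * (Q (s1 k) - Q (s2 k)) =
    function_distribution (fun p => m k (p.1 / p.2)) phi.
  apply: filterS step => k [s12 ma mb mc].
  by rewrite (step_distribution _ _ cphi boxphi _ _ _ _ _ _ s12 ma mb mc) /Q /J; ring.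
apply: cvg_trans; first exact: near_eq_cvg fdE.
apply: cvgD => //; apply: cvgD; first exact: cvg_cst.
by apply: cvgB; apply: cvgM => //; exact: cvg_cst.
Unshelve. all: by end_near. Qed.

End ThinLayers.

(** * Wave curves *)

Section Waves.
Context {R : realType}.
Variables (gamma : R).
Hypothesis gamma_gt1 : 1 < gamma.
Let gamma_gt0 : 0 < gamma := lt_trans ltr01 gamma_gt1.
Implicit Types (kappa q r x M : R) (ul ur us : gas_state R).

(** At [x = q / r], the factor by which the velocity jump of a shock of densities
    [q < r] falls short of its value in the limit of infinite compression. *)
Definition compression x : R := Num.sqrt ((1 - x `^ gamma) * (1 - x)).

Lemma compression_bounds x : 0 < x < 1 -> 1 - x <= compression x <= 1.
Proof.
move=> /andP[x0 x1]; have xg : x `^ gamma <= x by rewrite ge1r_powR ?x0 ?ltW.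
have xg0 : 0 <= x `^ gamma by exact: powR_ge0.
apply/andP; split; last by rewrite -[leRHS]sqrtr1 ler_wsqrtr//; nra.
have <- : Num.sqrt ((1 - x) ^+ 2) = 1 - x by rewrite sqrtr_sqr ger0_norm// subr_ge0 ltW.
by apply: ler_wsqrtr; nra.
Qed.

Definition shock_jump kappa q r : R :=
  Num.sqrt (kappa * (r `^ gamma - q `^ gamma) / (r * q * (r - q))) * (r - q).

(** The factor [sqrt (kappa * r `^ gamma)] is common to the two shocks of a
    Riemann solution, which share the intermediate density [r]; it cancels when
    their jumps are compared. *)
Lemma shock_jumpE kappa q r : 0 < kappa -> 0 < q < r ->
  shock_jump kappa q r * Num.sqrt q =
  Num.sqrt (kappa * r `^ gamma) * compression (q / r).
Proof.
move=> k0 /andP[q0 qr]; have r0 : 0 < r := lt_trans q0 qr.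
have dqr : 0 < r - q by rewrite subr_gt0.
have powqr : q `^ gamma = (q / r) `^ gamma * r `^ gamma.
  by rewrite -powRM ?divr_ge0 ?ltW// divfK ?gt_eqF.
have pr0 : 0 < r `^ gamma by exact: powR_gt0.
have powlt : q `^ gamma < r `^ gamma 
  by apply: gt0_ltr_powR; rewrite // nnegrE ltW.
rewrite /shock_jump /compression -{2}(ger0_norm (ltW dqr)) -sqrtr_sqr.
set X := kappa * _ / _; set Y := (1 - _) * _.
have X0 : 0 <= X by rewrite divr_ge0 ?mulr_ge0 ?subr_ge0 ?(ltW powlt) ?ltW.
rewrite -(sqrtrM _ X0) -(sqrtrM _ (mulr_ge0 X0 (sqr_ge0 _))) -sqrtrM ?mulr_ge0 1?ltW//.
rewrite /X /Y; congr Num.sqrt; rewrite powqr; field.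
by rewrite !gt_eqF.
Qed.

Lemma shock_jump_le kappa q r M : 0 < kappa -> 0 < q < r -> r <= M ->
  shock_jump kappa q r <= Num.sqrt (kappa * (M `^ gamma / q)).
Proof.
move=> k0 /andP[q0 qr] rM; have r0 := lt_trans q0 qr.
have sq0 : 0 < Num.sqrt q by rewrite sqrtr_gt0.
have qr01 : 0 < q / r < 1 by rewrite divr_gt0// ltr_pdivrMr ?mul1r.
have /andP[_ c1] := compression_bounds _ qr01.
rewrite -(ler_pM2r sq0) shock_jumpE ?q0//.
have M0 : 0 <= kappa * (M `^ gamma / q) by rewrite mulr_ge0 ?divr_ge0 ?powR_ge0 ?ltW.
rewrite -(sqrtrM _ M0) -!mulrA mulVf ?gt_eqF// mulr1.
apply: (@le_trans _ _ (Num.sqrt (kappa * r `^ gamma))).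
  by rewrite ler_piMr ?sqrtr_ge0.
apply: ler_wsqrtr; rewrite ler_pM2l// (ge0_ler_powR (ltW gamma_gt0))// nnegrE.
  exact: ltW.
exact: le_trans (ltW r0) rM.
Qed.

(** Only a shock lowers the velocity from left to right; the bound has to cover
    the other kinds of wave because they are excluded by means of it. *)
Lemma wave1_velocity_drop kappa k ul us M :
  0 < kappa -> 0 < density ul -> 0 < density us <= M ->
  wave1_relation gamma kappa k ul us ->
  velocity ul - velocity us <= Num.sqrt (kappa * (M `^ gamma / density ul)).
Proof.
move=> k0 ul0 /andP[us0 usM]; case: k => /= [->|[ru ->]|[ru ->]].
- by rewrite subrr sqrtr_ge0.
- apply: le_trans (sqrtr_ge0 _); rewrite opprD addrA subrr add0r oppr_le0.
  rewrite mulr_ge0// ?divr_ge0 ?mulr_ge0 ?sqrtr_ge0// ?subr_ge0 ?(ltW gamma_gt1)//.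
  by rewrite ge0_ler_powR ?nnegrE ?divr_ge0 ?subr_ge0 ?ltW.
- by rewrite opprB addrC subrK; apply: shock_jump_le; rewrite ?ul0.
Qed.

Lemma wave2_shock_jump kappa us ur : 0 < density ur < density us ->
  wave2_relation gamma kappa Shock us ur ->
  velocity us = velocity ur + shock_jump kappa (density ur) (density us).
Proof.
move=> /andP[ur0 lt] [_ ->]; congr (_ + Num.sqrt _ * _); field.
by rewrite !subr_eq0 (lt_eqF lt) (gt_eqF lt) (gt_eqF ur0) (gt_eqF (lt_trans ur0 lt)).
Qed.

Lemma wave2_velocity_drop kappa k us ur M :
  0 < kappa -> 0 < density ur -> 0 < density us <= M ->
  wave2_relation gamma kappa k us ur ->
  velocity us - velocity ur <= Num.sqrt (kappa * (M `^ gamma / density ur)).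
Proof.
move=> k0 ur0 /andP[us0 usM]; case: k => [/= ->|/= [ru ->]|w2].
- by rewrite subrr sqrtr_ge0.
- apply: le_trans (sqrtr_ge0 _); rewrite addrAC subrr add0r oppr_le0.
  rewrite mulr_ge0// ?divr_ge0 ?mulr_ge0 ?sqrtr_ge0// ?subr_ge0 ?(ltW gamma_gt1)//.
  by rewrite ge0_ler_powR ?nnegrE ?divr_ge0 ?subr_ge0 ?ltW.
- have [ru _] := w2; rewrite (wave2_shock_jump _ _ _ _ w2) ?ur0//.
  by rewrite addrC addKr; apply: shock_jump_le; rewrite ?ur0.
Qed.

End Waves.

(** * The limit of vanishing pressure *)

Section VanishingPressure.
Context {R : realType}.
Variables (gamma : R) (ul ur : gas_state R).
Hypotheses (gamma_gt1 : 1 < gamma) (ul_gt0 : 0 < density ul)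
  (ur_gt0 : 0 < density ur) (compressive : velocity ur < velocity ul).
Implicit Types (kappa : R) (us : R -> gas_state R).

(** With an intermediate density below [M], the two waves together could lower
    the velocity by at most [drop kappa], which tends to zero. *)
Lemma intermediate_density_cvgy us :
  (forall kappa, 0 < kappa -> 0 < density (us kappa) /\ exists k1 k2,
    wave1_relation gamma kappa k1 ul (us kappa) /\
    wave2_relation gamma kappa k2 (us kappa) ur) ->
  density (us kappa) @[kappa --> 0^'+] --> +oo.
Proof.
move=> waves; apply/cvgryPge => M.
pose drop kappa := Num.sqrt (kappa * (M `^ gamma / density ul)) +
  Num.sqrt (kappa * (M `^ gamma / density ur)).
have drop0 : drop kappa @[kappa --> 0^'+] --> 0.
  have half (A : R) : Num.sqrt (kappa * A) @[kappa --> 0^'+] --> 0.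
    suff : Num.sqrt (kappa * A) @[kappa --> 0^'+] --> Num.sqrt (0 * A).
      by rewrite mul0r sqrtr0.
    have lin : kappa * A @[kappa --> (0 : R)^'+] --> 0 * A.
      by apply: cvg_at_right_filter; apply: cvgM; [exact: cvg_id|exact: cvg_cst].
    exact: cvg_comp _ _ lin (@sqrt_continuous R _).
  have := cvgD (half (M `^ gamma / density ul)) (half (M `^ gamma / density ur)).
  by rewrite addr0; apply.
near=> kappa; have k0 : 0 < kappa by [].
have small : drop kappa < velocity ul - velocity ur.
  by near: kappa; apply: cvgr_lt drop0 _ _; rewrite subr_gt0.
have [r0 [k1 [k2 [w1 w2]]]] := waves _ k0.
rewrite leNgt; apply/negP => rM.
have rM' : 0 < density (us kappa) <= M by rewrite r0 ltW.
have := wave1_velocity_drop _ gamma_gt1 _ _ _ _ _ k0 ul_gt0 rM' w1.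
have := wave2_velocity_drop _ gamma_gt1 _ _ _ _ _ k0 ur_gt0 rM' w2.
by move: small; rewrite /drop; lra.
Unshelve. all: by end_near. Qed.

Lemma compression_cvg1 q (r : R -> R) : 0 < q -> r kappa @[kappa --> 0^'+] --> +oo ->
  compression gamma (q / r kappa) @[kappa --> 0^'+] --> (1 : R).
Proof.
move=> q0 ry.
have rV0 : (r kappa)^-1 @[kappa --> 0^'+] --> 0.
  by apply/gtr0_cvgV0 => //; exact: cvgry_gt.
have low : 1 - q / r kappa @[kappa --> 0^'+] --> (1 : R).
  by have := cvgB (cvg_cst (1 : R)) (cvgM (cvg_cst q) rV0); rewrite mulr0 subr0; apply.
apply: (squeeze_cvgr _ low (cvg_cst (1 : R))); near=> kappa.
have qr : q < r kappa by near: kappa; exact: cvgry_gt.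
by apply: compression_bounds => //; rewrite divr_gt0 ?ltr_pdivrMr ?mul1r// (lt_trans q0).
Unshelve. all: by end_near. Qed.

Definition two_shocks kappa (u : gas_state R) : Prop :=
  [/\ density ul < density u, density ur < density u,
    velocity u = velocity ul - shock_jump gamma kappa (density ul) (density u)
    & velocity u = velocity ur + shock_jump gamma kappa (density ur) (density u)].

Variable us : R -> gas_state R.
Hypotheses (density_us : density (us kappa) @[kappa --> 0^'+] --> +oo)
  (shocks : \forall kappa \near 0^'+, two_shocks kappa (us kappa)).

(** Eliminating the common factor from the two instances of [shock_jumpE] leaves
    a linear equation for the intermediate velocity, whose coefficients converge
    because the compression factors tend to one. *)
Lemma intermediate_velocity_cvg :
  velocity (us kappa) @[kappa --> 0^'+] --> delta_shock_speed ul ur.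
Proof.
have [sl0 sr0] : 0 < Num.sqrt (density ul) /\ 0 < Num.sqrt (density ur).
  by rewrite !sqrtr_gt0.
pose a := Num.sqrt (density ul); pose b := Num.sqrt (density ur).
pose d := velocity ul - velocity ur.
pose thl kappa := compression gamma (density ul / density (us kappa)).
pose thr kappa := compression gamma (density ur / density (us kappa)).
have thl1 : thl kappa @[kappa --> 0^'+] --> (1 : R) by exact: compression_cvg1.
have thr1 : thr kappa @[kappa --> 0^'+] --> (1 : R) by exact: compression_cvg1.
have -> : delta_shock_speed ul ur =
    velocity ur + d * a * 1 / (b * 1 + a * 1).
  by rewrite /delta_shock_speed /d -/a -/b; field; rewrite gt_eqF// addr_gt0.
have lim : velocity ur + d * a * thr kappa / (b * thl kappa + a * thr kappa)
    @[kappa --> 0^'+] --> velocity ur + d * a * 1 / (b * 1 + a * 1).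
  apply: cvgD; first exact: cvg_cst.
  apply: cvgM; first by apply: cvgM => //; exact: cvg_cst.
  apply: cvgV; first by rewrite !mulr1 gt_eqF// addr_gt0.
  by apply: cvgD; apply: cvgM => //; exact: cvg_cst.
apply: cvg_trans lim; apply: near_eq_cvg; near=> kappa.
have k0 : 0 < kappa by [].
have [lu ru vl vr] : two_shocks kappa (us kappa) by near: kappa.
have thl0 : 0 < thl kappa by near: kappa; apply: cvgr_gt thl1 _ _; exact: ltr01.
have thr0 : 0 < thr kappa by near: kappa; apply: cvgr_gt thr1 _ _; exact: ltr01.
have := shock_jumpE _ gamma_gt1 _ _ _ k0 (_ : 0 < density ul < density (us kappa)).
have := shock_jumpE _ gamma_gt1 _ _ _ k0 (_ : 0 < density ur < density (us kappa)).
rewrite ul_gt0 ur_gt0 lu ru -/(thl kappa) -/(thr kappa) -/a -/b.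
set N := Num.sqrt _ => /(_ isT) jr /(_ isT) jl.
have vE : velocity (us kappa) - velocity ur =
    shock_jump gamma kappa (density ur) (density (us kappa)).
  by rewrite vr addrC addKr.
have vE' : velocity ul - velocity (us kappa) =
    shock_jump gamma kappa (density ul) (density (us kappa)).
  by rewrite vl opprB addrC subrK.
rewrite -vE in jr; rewrite -vE' in jl.
have den0 : b * thl kappa + a * thr kappa != 0.
  by rewrite gt_eqF// addr_gt0// mulr_gt0.
apply/eqP; rewrite -subr_eq0.
suff -> : velocity ur + d * a * thr kappa / (b * thl kappa + a * thr kappa) -
   velocity (us kappa) =
   ((velocity ul - velocity (us kappa)) * a * thr kappa -
    (velocity (us kappa) - velocity ur) * b * thl kappa) /
   (b * thl kappa + a * thr kappa).
  by rewrite jl jr mulrAC subrr mul0r.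
by rewrite /d; field.
Unshelve. all: by end_near. Qed.

Lemma density_ratio_cvg0 q :
  q / (density (us kappa) - q) @[kappa --> 0^'+] --> 0.
Proof.
have y : density (us kappa) - q @[kappa --> 0^'+] --> +oo.
  apply/cvgryPge => M; near=> kappa; rewrite lerBrDr; near: kappa.
  exact: cvgry_ge.
have V0 : (density (us kappa) - q)^-1 @[kappa --> 0^'+] --> 0.
  by apply/gtr0_cvgV0 => //; exact: cvgry_gt.
by have := cvgM (cvg_cst q) V0; rewrite mulr0; apply.
Unshelve. all: by end_near. Qed.

Let shock1_speed kappa := rankine_hugoniot_speed ul (us kappa).
Let shock2_speed kappa := rankine_hugoniot_speed (us kappa) ur.

Let shock1_speedE : \forall kappa \near 0^'+,
  velocity (us kappa) - density ul / (density (us kappa) - density ul) *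
    (velocity ul - velocity (us kappa)) = shock1_speed kappa.
Proof.
apply: filterS shocks => kappa [lu _ _ _].
rewrite /shock1_speed /rankine_hugoniot_speed /momentum; field.
by rewrite gt_eqF// subr_gt0.
Qed.

Let shock2_speedE : \forall kappa \near 0^'+,
  velocity (us kappa) + density ur / (density (us kappa) - density ur) *
    (velocity (us kappa) - velocity ur) = shock2_speed kappa.
Proof.
apply: filterS shocks => kappa [_ ru _ _].
rewrite /shock2_speed /rankine_hugoniot_speed /momentum; field.
by rewrite !subr_eq0 (gt_eqF ru) (lt_eqF ru).
Qed.

Let sigma := delta_shock_speed ul ur.

Lemma shock1_speed_cvg : shock1_speed kappa @[kappa --> 0^'+] --> sigma.
Proof.
apply: cvg_trans; first exact: near_eq_cvg shock1_speedE.
have v := intermediate_velocity_cvg.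
have := cvgB v (cvgM (density_ratio_cvg0 (density ul)) (cvgB (cvg_cst (velocity ul)) v)).
by rewrite mul0r subr0; apply.
Qed.

Lemma shock2_speed_cvg : shock2_speed kappa @[kappa --> 0^'+] --> sigma.
Proof.
apply: cvg_trans; first exact: near_eq_cvg shock2_speedE.
have v := intermediate_velocity_cvg.
have := cvgD v (cvgM (density_ratio_cvg0 (density ur)) (cvgB v (cvg_cst (velocity ur)))).
by rewrite mul0r addr0; apply.
Qed.

Let layer_width kappa := shock2_speed kappa - shock1_speed kappa.

(** Each shock speed differs from the intermediate velocity by
    [q / (r - q)] times the velocity jump, [q] being the outer density; multiplied
    by the intermediate density [r] this has the limit [q] times the limit jump. *)
Lemma layer_mass_cvg :
  density (us kappa) * layer_width kappa @[kappa --> 0^'+] -->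
  delta_shock_weight ul ur 1.
Proof.
have massE : \forall kappa \near 0^'+,
    density ur * (1 + density ur / (density (us kappa) - density ur)) *
      (velocity (us kappa) - velocity ur) +
    density ul * (1 + density ul / (density (us kappa) - density ul)) *
      (velocity ul - velocity (us kappa)) =
    density (us kappa) * layer_width kappa.
  near=> kappa; have [lu ru _ _] : two_shocks kappa (us kappa) by near: kappa.
  have s1E := near shock1_speedE kappa; have s2E := near shock2_speedE kappa.
  rewrite /layer_width -s1E// -s2E//.
  by field; rewrite !subr_eq0 (gt_eqF lu) (gt_eqF ru).
apply: cvg_trans; first exact: near_eq_cvg massE.
have v := intermediate_velocity_cvg.
have ratio q := cvgM (cvg_cst q) (cvgD (cvg_cst (1 : R)) (density_ratio_cvg0 q)).
have -> : delta_shock_weight ul ur 1 = density ur * (1 + 0) * (sigma - velocity ur) +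
    density ul * (1 + 0) * (velocity ul - sigma).
  rewrite /sigma /delta_shock_speed /delta_shock_weight sqrtrM ?ltW//.
  set a := Num.sqrt _; set b := Num.sqrt _.
  have -> : density ul = a ^+ 2 by rewrite sqr_sqrtr ?ltW.
  have -> : density ur = b ^+ 2 by rewrite sqr_sqrtr ?ltW.
  by field; rewrite gt_eqF// addr_gt0 ?sqrtr_gt0.
apply: cvgD; apply: cvgM; [exact: ratio| |exact: ratio|]; apply: cvgB => //; exact: cvg_cst.
Unshelve. all: by end_near. Qed.

Lemma layer_momentum_cvg :
  momentum (us kappa) * layer_width kappa @[kappa --> 0^'+] -->
  sigma * delta_shock_weight ul ur 1.
Proof.
have -> : (fun kappa => momentum (us kappa) * layer_width kappa) =
    (fun kappa => velocity (us kappa) * (density (us kappa) * layer_width kappa)).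
  by apply/funext => kappa; rewrite /momentum mulrA [velocity _ * _]mulrC.
exact: cvgM intermediate_velocity_cvg layer_mass_cvg.
Qed.

(** The order of the speeds follows from the positivity of the limit strength. *)
Lemma layer_width_gt0 :
  \forall kappa \near 0^'+, shock1_speed kappa < shock2_speed kappa.
Proof.
have w0 : 0 < delta_shock_weight ul ur 1.
  by rewrite /delta_shock_weight mul1r mulr_gt0 ?sqrtr_gt0 ?mulr_gt0 ?subr_gt0.
near=> kappa; rewrite -subr_gt0.
have r0 : 0 < density (us kappa) by near: kappa; exact: cvgry_gt.
by rewrite -(pmulr_rgt0 _ r0); near: kappa; exact: cvgr_gt layer_mass_cvg _ w0.
Unshelve. all: by end_near. Qed.

End VanishingPressure.

(** * Convergence to the delta-shock *)

(** [riemann_solution_of_kind] with the intermediate state exposed, so that the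
    intermediate states for all [kappa] can be chosen as one function. *)
Definition riemann_solution_through {R : realType} (gamma kappa : R) k1 k2
    (ul ur us : gas_state R) (U : R -> gas_state R) : Prop :=
  [/\ 0 < density us, wave1_relation gamma kappa k1 ul us
    & wave2_relation gamma kappa k2 us ur] /\
  let l1 := lambda1 gamma kappa in let l2 := lambda2 gamma kappa in
  [/\ forall xi, xi < wave_left_edge l1 k1 ul us -> U xi = ul,
      wave_profile l1 (riemann_invariant1 gamma kappa) k1 ul us U,
      forall xi, wave_right_edge l1 k1 ul us < xi < wave_left_edge l2 k2 us ur ->
        U xi = us,
      wave_profile l2 (riemann_invariant2 gamma kappa) k2 us ur U
    & forall xi, wave_right_edge l2 k2 us ur < xi -> U xi = ur].

Theorem theorem3p2 (R : realType) (gamma rhom rhop vm vp : R)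
    (hgamma : 1 < gamma) (hrhom : 0 < rhom) (hrhop : 0 < rhop) (hv : vp < vm)
    (U : R -> R -> gas_state R)
    (hU : forall kappa : R, 0 < kappa ->
      is_riemann_solution gamma kappa
        (GasState rhom vm) (GasState rhop vp) (U kappa))
    (hSR : exists2 kappa0 : R, 0 < kappa0 &
      riemann_solution_of_kind gamma kappa0 Shock Rarefaction
        (GasState rhom vm) (GasState rhop vp) (U kappa0)) :
  cvg_distribution
    (fun kappa : R =>
      function_distribution (fun p : R * R => density (U kappa (p.1 / p.2))))
    0^'+
    (measure_family_distribution
      (delta_shock_density (GasState rhom vm) (GasState rhop vp))) /\
  cvg_distribution
    (fun kappa : R =>
      function_distribution (fun p : R * R => momentum (U kappa (p.1 / p.2))))
    0^'+
    (measure_family_distribution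
      (delta_shock_momentum (GasState rhom vm) (GasState rhop vp))).
Proof.
set ul := GasState rhom vm; set ur := GasState rhop vp.
have ul0 : 0 < density ul by []; have ur0 : 0 < density ur by [].
have compressive : velocity ur < velocity ul by [].
have /choice[us usP] : forall kappa, exists u, 0 < kappa -> exists k1 k2,
    riemann_solution_through gamma kappa k1 k2 ul ur u (U kappa).
  move=> kappa; have [/hU[k1 [k2 [u uP]]]|k0] := pselect (0 < kappa).
    by exists u => _; exists k1, k2.
  by exists ul => /k0.
have waves kappa : 0 < kappa -> 0 < density (us kappa) /\ exists k1 k2,
    wave1_relation gamma kappa k1 ul (us kappa) /\
    wave2_relation gamma kappa k2 (us kappa) ur.
  by move=> /usP[k1 [k2 [[u0 w1 w2] _]]]; split=> //; exists k1, k2.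
have density_us := intermediate_density_cvgy _ _ _ hgamma ul0 ur0 compressive _ waves.
have shocks : \forall kappa \near 0^'+, two_shocks gamma ul ur kappa (us kappa) /\
    riemann_solution_through gamma kappa Shock Shock ul ur (us kappa) (U kappa).
  near=> kappa; have k0 : 0 < kappa by [].
  have lu : density ul < density (us kappa) by near: kappa; exact: cvgry_gt.
  have ru : density ur < density (us kappa) by near: kappa; exact: cvgry_gt.
  have [k1 [k2 sol]] := usP _ k0; have [[u0 w1 w2] _] := sol.
  (* An absent wave or a rarefaction would not exceed the outer density. *)
  move: sol w1; case: k1 => [_ w1|_ []|sol w1].
  - by rewrite w1 ltxx in lu.
  - by rewrite (lt_gtF lu).
  move: sol w2; case: k2 => [_ w2|_ []|sol w2].
  - by rewrite -w2 ltxx in ru.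
  - by rewrite (lt_gtF ru).
  split=> //; split=> //; first by have [] := w1.
  by apply: wave2_shock_jump w2; rewrite ur0.
have two : \forall kappa \near 0^'+, two_shocks gamma ul ur kappa (us kappa).
  by apply: filterS shocks => kappa [].
have s1 := shock1_speed_cvg _ _ _ hgamma ul0 ur0 _ density_us two.
have s2 := shock2_speed_cvg _ _ _ hgamma ul0 ur0 _ density_us two.
have width := layer_width_gt0 _ _ _ hgamma ul0 ur0 compressive _ density_us two.
have step (f : gas_state R -> R) : \forall kappa \near 0^'+,
    let s1 := rankine_hugoniot_speed ul (us kappa) in
    let s2 := rankine_hugoniot_speed (us kappa) ur in
    [/\ s1 < s2, forall xi, xi < s1 -> f (U kappa xi) = f ul,
      forall xi, s1 < xi < s2 -> f (U kappa xi) = f (us kappa)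
      & forall xi, s2 < xi -> f (U kappa xi) = f ur].
  apply: filterS2 width shocks => kappa s12 [_ [_ [left _ middle _ right]]].
  by split=> // xi xiP; [rewrite left|rewrite middle|rewrite right].
have weightE t : delta_shock_weight ul ur t = delta_shock_weight ul ur 1 * t.
  by rewrite /delta_shock_weight; ring.
split.
- rewrite (_ : delta_shock_density ul ur = fun t => jump_dirac_measure
      (delta_shock_speed ul ur * t) (density ul) (density ur)
      (delta_shock_weight ul ur 1 * t)).
    apply: (thin_layer_cvg_distribution _ _ _ _ _ _ _ _ _ s1 s2 _ (step (@density R))).
    exact: (layer_mass_cvg _ _ _ hgamma ul0 ur0 _ density_us two).
  by apply/funext => t; rewrite /delta_shock_density weightE.
- rewrite (_ : delta_shock_momentum ul ur = fun t => jump_dirac_measure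
      (delta_shock_speed ul ur * t) (momentum ul) (momentum ur)
      (delta_shock_speed ul ur * delta_shock_weight ul ur 1 * t)).
    apply: (thin_layer_cvg_distribution _ _ _ _ _ _ _ _ _ s1 s2 _ (step (@momentum R))).
    exact: (layer_momentum_cvg _ _ _ hgamma ul0 ur0 _ density_us two).
  by apply/funext => t; rewrite /delta_shock_momentum weightE mulrA.
Unshelve. all: by end_near. Qed.
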